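(* Let $\alpha\in(0,1)$ be irrational. (i) The map $$\Psi_\alpha : E_{(\alpha)}\to\mathbb{N},\qquad d\mapsto\sum_{j=1}^\infty d_jq_{j-1}$$ is an order isomorphism from $(E_{(\alpha)},\leqslant_R)$ to $(\mathbb{N},\leqslant)$. (ii) The map $$\Lambda_\alpha : E_\alpha\to[0,1),\qquad d\mapsto\sum_{j=1}^\infty(-1)^{j-1}d_j\delta_{j-1}$$ is an order isomorphism from $(E_\alpha,\leqslant_A)$ to $([0,1),\leqslant)$. (iii) For all $n\in\mathbb{N}$, $\{n\alpha\}=\Lambda_\alpha(\Psi_\alpha^{-1}(n))$.
   Context: $\mathbb{N}$ is the set of nonnegative integers and $\{x\}$ the fractional part of $x$. For irrational $\alpha\in(0,1)$ let $[0,a_1,a_2,\dots]$ be its continued fraction expansion (each $a_k$ a positive integer), and $p_k/q_k=[0,a_1,\dots,a_k]$ its reduced convergents, with $p_{-1}=1,\ q_{-1}=0,\ p_0=0,\ q_0=1$. Put $\delta_i=(-1)^i(q_i\alpha-p_i)$ for $i\geqslant-1$ (so $\delta_{-1}=1$, $\delta_0=\alpha$). $E_\alpha$ is the set of $\alpha$-admissible sequences: sequences $d=(d_j)_{j\geqslant1}$ of nonnegative integers such that (a) $0\leqslant d_j\leqslant a_j$ for all $j\geqslant1$; (b) if $d_j=0$ then either $d_i=0$ for all $i\geqslant j$, or $j\geqslant2$ and $d_{j-1}=a_{j-1}$; (c) $d$ does not end with $(a_k,0,a_{k+2},0,\dots)$, i.e. there is no $k\geqslant1$ such that $d_{k+2i}=a_{k+2i}$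 and $d_{k+2i+1}=0$ for all $i\geqslant0$. $E_{(\alpha)}$ is the subset of sequences in $E_\alpha$ that are eventually $0$. Reversed lexicographic order: $d\leqslant_R d'$ iff $d=d'$ or there is $j\geqslant1$ with $d_j<d'_j$ and $d_i=d'_i$ for all $i>j$. Alternate lexicographic order: $d\leqslant_A d'$ iff $d=d'$ or there is $j\geqslant1$ with $(-1)^{j-1}d_j<(-1)^{j-1}d'_j$ and $d_i=d'_i$ for all $1\leqslant i<j$. *)

(* Defs.v *)
From mathcomp Require Import all_boot all_order all_algebra.
From mathcomp Require Import all_classical all_reals all_analysis.

Set Implicit Arguments.
Unset Strict Implicit.
Unset Printing Implicit Defensive.

Import Order.TTheory GRing.Theory Num.Theory.
Import numFieldNormedType.Exports.

Local Open Scope classical_set_scope.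
Local Open Scope ring_scope.

Definition order_iso (T U : Type) (A : set T) (leT : T -> T -> Prop)
    (B : set U) (leU : rel U) (f : T -> U) : Prop :=
  set_bij A B f /\
  (forall x y, A x -> A y -> (leT x y <-> leU (f x) (f y))).

Definition frac_part (R : realType) (x : R) : R := x - (Num.floor x)%:~R.

(* Sequences indexed by j >= 1 in the usual notation are functions on nat
   shifted by one: [d i] stands for $d_{i+1}$ and [partial_quotient alpha i]
   for $a_{i+1}$. The convergents $p_k/q_k$ and $\delta_k$ keep their index. *)

(* $a_{i+1} = \lfloor 1/G^i(\alpha) \rfloor$, with $G(x) = \{1/x\}$ the Gauss
   map. *)
Definition partial_quotient (R : realType) (alpha : R) (i : nat) : nat :=
  Num.truncn (iter i (fun x => frac_part x^-1) alpha)^-1.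

(* $[0, s_1, ..., s_k]$ *)
Fixpoint cfrac (s : seq nat) : rat :=
  if s is a :: s' then (a%:R + cfrac s')^-1 else 0.

Definition convergent (R : realType) (alpha : R) (k : nat) : rat :=
  cfrac (mkseq (partial_quotient alpha) k).

(* [numq] and [denq] give the reduced form with positive denominator; in
   particular $p_0 = 0$ and $q_0 = 1$. *)
Definition cf_num (R : realType) (alpha : R) (k : nat) : int :=
  numq (convergent alpha k).

Definition cf_den (R : realType) (alpha : R) (k : nat) : nat :=
  `|denq (convergent alpha k)|%N.

Definition cf_delta (R : realType) (alpha : R) (i : nat) : R :=
  (-1) ^+ i * ((cf_den alpha i)%:R * alpha - (cf_num alpha i)%:~R).

Definition admissible (R : realType) (alpha : R) : set (nat -> nat) :=
  [set d | [/\ forall j, (d j <= partial_quotient alpha j)%N,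
    forall j, d j = 0%N ->
      (forall i, (j <= i)%N -> d i = 0%N) \/
      ((0 < j)%N /\ d j.-1 = partial_quotient alpha j.-1)
  & ~ exists k, forall i,
      d (k + i.*2)%N = partial_quotient alpha (k + i.*2)%N /\
      d (k + i.*2).+1 = 0%N]].

Definition fin_admissible (R : realType) (alpha : R) : set (nat -> nat) :=
  [set d | admissible alpha d /\ exists N, forall i, (N <= i)%N -> d i = 0%N].

Definition le_revlex (d d' : nat -> nat) : Prop :=
  d = d' \/
  exists j, (d j < d' j)%N /\ forall i, (j < i)%N -> d i = d' i.

(* The sign $(-1)^{j-1}$ becomes $(-1)^j$ under the index shift. *)
Definition le_altlex (d d' : nat -> nat) : Prop :=
  d = d' \/
  exists j, (-1) ^+ j * (d j)%:Z < (-1) ^+ j * (d' j)%:Z /\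
            forall i, (i < j)%N -> d i = d' i.

(* Sum over the finite support of the summand. *)
Definition Psi (R : realType) (alpha : R) (d : nat -> nat) : nat :=
  \big[addn/0%N]_(j \in [set: nat]) (d j * cf_den alpha j)%N.

(* The default value of [pinv_] is used only outside the image of [Psi]. *)
Definition Psi_inv (R : realType) (alpha : R) : nat -> nat -> nat :=
  'pinv_(fun=> fun=> 0%N) (fin_admissible alpha) (Psi alpha).

Definition Lambda_terms (R : realType) (alpha : R) (d : nat -> nat) : R^nat :=
  fun j => (-1) ^+ j * (d j)%:R * cf_delta alpha j.

Definition Lambda (R : realType) (alpha : R) (d : nat -> nat) : R :=
  limn (series (Lambda_terms alpha d)).

(* Main.v *)
Require Import Defs.
From mathcomp Require Import all_boot all_order all_algebra.
From mathcomp Require Import all_classical all_reals all_analysis.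
From mathcomp Require Import zify ring lra.

Import Order.TTheory GRing.Theory Num.Theory.
Import numFieldNormedType.Exports.
Local Open Scope classical_set_scope.
Local Open Scope ring_scope.

(** Both maps evaluate the same digits $d_j$ against weights obeying opposite
recurrences: the denominators grow by $q_{j+1} = a_{j+1} q_j + q_{j-1}$, and
the distances $\delta_j$ shrink by
$\delta_{j+1} = \delta_{j-1} - a_{j+1} \delta_j$. The proof is about these
recurrences; that the convergents satisfy them is a separate and classical
matter, reached through the orbit of $\alpha$ under the Gauss map.

Integers. Below a nonzero digit $d_j$, every zero has a full digit just below
it, and $a_{j-2} q_{j-3} + q_{j-4} = q_{j-2}$; so the digits below $d_j$ always
contribute at least $q_{j-2}$ ([weight_le_digit_sum]). They contribute less
than $q_{j-1} + q_{j-2}$, since this is one more than the sum with all digits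
full ([digit_sum_lt]). These bounds are one unit $q_{j-1}$ of the digit $d_j$
apart. Hence the highest difference of two sequences decides, and division with
remainder from the top finds the digits of any integer ([digit_sum_surj]).

Reals. Write $x$ as a partial sum plus $(-1)^m T_m$. The scaled tails satisfy
$T_{m+1} = d_{m+1} \delta_m - T_m$ and tend to 0, and sequences with these two
properties are what is studied ([remainders]). Over two steps the gap
$\delta_{m-1} - T_m$ can only decrease, and it tends to 0, so
$T_m \leq \delta_{m-1}$; equality at some $m$ forces the alternation of full
and zero digits excluded by condition (c) ([remainder_lt]). One step back this
upper bound becomes a lower bound, and condition (b) turns it into
$T_m \geq 0$ whenever the previous digit is not full ([remainder_ge0]). These
two bounds make the first difference of two sequences decisive, and taking
digits by rounding up, capped at the partial quotient, keeps the remainders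
within the bounds and so expands every $x$ in $[0,1)$
([greedy_digits_admissible]).

Finally $\delta_j$ differs from $(-1)^j q_j \alpha$ by an integer, so on finite
sequences $\Lambda_\alpha(d)$ and $\Psi_\alpha(d)\alpha$ differ by an
integer; as $\Lambda_\alpha(d)$ lies in $[0,1)$, it is the fractional part
([frac_part_Psi]). *)

(** * Digit expansions of the natural numbers *)

Section Numeration.

Variables (a : nat -> nat) (a_gt0 : forall j, (0 < a j)%N).
(* With the index shift used for digits, [W j] stands for $q_{j-1}$: the digit
   of index [j] has weight [W j.+1]. *)
Variables (W : nat -> nat) (W0 : W 0 = 0%N) (W1 : W 1 = 1%N).
Hypothesis WSS : forall j, W j.+2 = (a j * W j.+1 + W j)%N.

Definition digit_sum (d : nat -> nat) (k : nat) : nat :=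
  (\sum_(j < k) d j * W j.+1)%N.

Definition zeros_after_full (d : nat -> nat) (k : nat) : Prop :=
  forall j, (j < k)%N -> d j = 0%N -> (0 < j)%N /\ d j.-1 = a j.-1.

Lemma digit_sumS d k : digit_sum d k.+1 = (digit_sum d k + d k * W k.+1)%N.
Proof. by rewrite /digit_sum big_ord_recr. Qed.

Lemma eq_digit_sum d d' k :
  (forall j, (j < k)%N -> d j = d' j) -> digit_sum d k = digit_sum d' k.
Proof. by move=> dd'; apply: eq_bigr => j _; rewrite dd'. Qed.

Lemma weight_gt0 k : (0 < W k.+1)%N.
Proof.
by elim: k => [|k IHk]; rewrite ?W1 // WSS addn_gt0 muln_gt0 a_gt0 IHk.
Qed.

(** The sum with all digits full telescopes, because
[a j * W j.+1 = W j.+2 - W j]. *)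
Lemma digit_sum_lt d k :
  (forall j, (d j <= a j)%N) -> (digit_sum d k < W k.+1 + W k)%N.
Proof.
move=> d_le; elim: k => [|k IHk]; first by rewrite /digit_sum big_ord0 W0 W1.
rewrite digit_sumS WSS; have := leq_mul (d_le k) (leqnn (W k.+1)); lia.
Qed.

(** The extreme case ends with $(\dots, a, 0, a, 0)$: a full digit at [k] with a
zero above it contributes [W k.+2 - W k], and the digits below supply the
missing [W k] by induction. *)
Lemma weight_le_digit_sum d k :
  zeros_after_full d k -> (W k <= digit_sum d k)%N.
Proof.
have [n] := ubnP k; elim: n k => // n IHn [|k] ltkn zd; first by rewrite W0.
rewrite digit_sumS; case dk: (d k) => [|c]; last by rewrite mulSn; lia.
have [] := zd k (ltnSn k) dk; case: k => // k in ltkn zd dk *; move=> _ /= dpk.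
rewrite addn0 digit_sumS dpk WSS addnC leq_add2r IHn //; first by lia.
by move=> j ltjk; apply: zd; lia.
Qed.

(** The digits below [j] add less than [W j.+1 + W j] to [d] and at least
[W j] to [d'], so they cannot make up for one unit [W j.+1] at [j]. *)
Lemma digit_sum_strict_mono d d' j :
  (forall i, (d i <= a i)%N) -> zeros_after_full d' j -> (d j < d' j)%N ->
  (digit_sum d j.+1 < digit_sum d' j.+1)%N.
Proof.
move=> d_le zd' ltdd'; rewrite !digit_sumS.
have lo := weight_le_digit_sum _ _ zd'; have hi := digit_sum_lt _ j d_le.
have := leq_mul ltdd' (leqnn (W j.+1)); rewrite mulSn; lia.
Qed.

(** Division with remainder from the top. The bottom part of the interval,
below [W k + W k.-1], is out of reach of a nonzero top digit: it is covered by
a zero on top of a full digit. *)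
Lemma digit_sum_surj k n : (W k <= n < W k.+1 + W k)%N ->
  exists d, [/\ forall j, (d j <= a j)%N, zeros_after_full d k,
    forall j, (k <= j)%N -> d j = 0%N & digit_sum d k = n].
Proof.
have [N] := ubnP k; elim: N k n => // N IHN [|m] n ltmN /andP[lo hi].
  exists (fun=> 0%N); split => //; rewrite /digit_sum big_ord0.
  by move: hi; rewrite W0 W1; lia.
have [nlow|nhigh] := ltnP n (W m.+1 + W m).
  case: m => [|p] in ltmN lo hi nlow *; first by move: nlow; rewrite W0; lia.
  move: lo nlow; rewrite WSS => lo nlow.
  have [||d [d_le zd d0 vd]] := IHN p (n - a p * W p.+1)%N; [lia|lia|].
  exists (fun j => if j == p then a p else d j); split.
  - by move=> j; case: eqP => [->|].
  - move=> j ltjp; case: eqP => [-> ap0|nejp dj0].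
      by have := a_gt0 p; rewrite ap0.
    have [->|nejp1] := eqVneq j p.+1; first by rewrite /= eqxx.
    have [|j_gt0 djp] := zd j _ dj0; first by lia.
    by split=> //; case: eqP => [->|].
  - by move=> j ltpj; case: eqP => [|_]; [lia|apply: d0; lia].
  - rewrite !digit_sumS eqxx (_ : (p.+1 == p) = false); last by lia.
    rewrite (d0 p.+1) // (eq_digit_sum _ d); first by rewrite vd; lia.
    by move=> j ltjp; case: eqP => //; lia.
(* The offset [W m] leaves a remainder that the lower digits can represent:
   their sums start at [W m], not at 0. *)
set c := ((n - W m) %/ W m.+1)%N.
have Wm := weight_gt0 m.
have c_gt0 : (0 < c)%N by rewrite divn_gt0 //; lia.
have c_le : (c <= a m)%N.
  by rewrite -ltnS ltn_divLR // mulSn; move: hi; rewrite WSS; lia.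
have cE := divn_eq (n - W m) (W m.+1); have cm := ltn_pmod (n - W m) Wm.
have [||d [d_le zd d0 vd]] := IHN m (n - c * W m.+1)%N; [lia|rewrite /c; lia|].
exists (fun j => if j == m then c else d j); split.
- by move=> j; case: eqP => [->|].
- move=> j ltjm; case: eqP => [-> c0|nejm dj0]; first by rewrite c0 in c_gt0.
  have [|j_gt0 djp] := zd j _ dj0; first by lia.
  by split=> //; case: eqP => [|_ //]; lia.
- by move=> j ltmj; case: eqP => [|_]; [lia|apply: d0; lia].
- rewrite digit_sumS eqxx (eq_digit_sum _ d) ?vd; first by rewrite /c; lia.
  by move=> j ltjm; case: eqP => //; lia.
Qed.

End Numeration.

(** * Alternating expansions of the real numbers *)

(** The set [admissible alpha] depends on [alpha] only through its partial
quotients. *)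
Definition admissible_for (a : nat -> nat) : set (nat -> nat) :=
  [set d | [/\ forall j, (d j <= a j)%N,
    forall j, d j = 0%N ->
      (forall i, (j <= i)%N -> d i = 0%N) \/
      ((0 < j)%N /\ d j.-1 = a j.-1)
  & ~ exists k, forall i,
      d (k + i.*2)%N = a (k + i.*2)%N /\ d (k + i.*2).+1 = 0%N]].

(** A sequence with limit 0 cannot be negative at the start of a nonincreasing
subsequence. *)
Lemma even_steps_ge0 (R : realType) (U : R^nat) (k : nat) : U @ \oo --> 0 ->
  (forall i, U (k + i.*2).+2 <= U (k + i.*2)%N) -> 0 <= U k.
Proof.
move=> U0 Ustep; rewrite leNgt; apply/negP => Uk_lt0.
have Ule i : U (k + i.*2)%N <= U k.
  elim: i => [|i IHi]; first by rewrite addn0.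
  by rewrite doubleS !addnS (le_trans (Ustep i)).
have /cvgr0Pnorm_lt/(_ (- U k)) := U0; rewrite oppr_gt0 => /(_ Uk_lt0)[N _ UN].
have := UN (k + N.*2)%N; rewrite /= => /(_ ltac:(lia)).
by have := Ule N; rewrite ltr_norml => ? /andP[? ?]; lra.
Qed.

Lemma cvg0_eq_norm (R : realType) (u v : R^nat) :
  (forall n, `|u n| = `|v n|) -> u @ \oo --> 0 -> v @ \oo --> 0.
Proof.
move=> uv /cvgr0Pnorm_lt u0; apply/cvgr0Pnorm_lt => e /u0[N _ uN].
by exists N => // n Nn; rewrite /= -uv; apply: uN.
Qed.

Section AlternatingExpansion.

Variables (R : realType) (a : nat -> nat) (a_gt0 : forall j, (0 < a j)%N).
(* [D j] stands for $\delta_{j-1}$, so that the digit of index [j] has weight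
   [D j.+1]. *)
Variables (D : R^nat) (D_gt0 : forall j, 0 < D j).
Hypothesis D_lt : forall j, D j.+1 < D j.
Hypothesis DSS : forall j, D j.+2 = D j - (a j)%:R * D j.+1.

Definition alt_terms (d : nat -> nat) : R^nat :=
  fun j => (-1) ^+ j * (d j)%:R * D j.+1.

Definition alt_sum (d : nat -> nat) : R := limn (series (alt_terms d)).

(** Absolute convergence: the series of [a j * D j.+1 = D j - D j.+2]
telescopes. *)
Lemma alt_series_cvg d :
  (forall j, (d j <= a j)%N) -> cvgn (series (alt_terms d)).
Proof.
move=> d_le; apply: normed_cvg; apply: nondecreasing_is_cvgn.
  by apply: nondecreasing_series => n _ _; apply: normr_ge0.
exists (D 0 + D 1) => _ [n _ <-].
suff : series (fun j => `|alt_terms d j|) n <= D 0 + D 1 - D n - D n.+1.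
  have := D_gt0 n; have := D_gt0 n.+1.
  rewrite -[X in _ -> _ -> _ -> X <= _]/(series (fun j => `|alt_terms d j|) n).
  lra.
elim: n => [|n IHn]; first by rewrite /series /= big_geq //; lra.
rewrite seriesSr {2}/alt_terms !normrM normrX normrN1 expr1n mul1r.
rewrite normr_nat (gtr0_norm (D_gt0 _)) DSS.
have : (d n)%:R * D n.+1 <= (a n)%:R * D n.+1.
  by rewrite ler_pM2r // ler_nat.
lra.
Qed.

(** The constant digits 1 are bounded by [a], and the terms of a convergent
series tend to 0. *)
Lemma weights_cvg0 : D @ \oo --> 0.
Proof.
rewrite -(cvg_shiftS D).
have /alt_series_cvg/cvg_series_cvg_0 :
  forall j, ((fun=> 1%N) j <= a j)%N by [].
apply: cvg0_eq_norm => j.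
by rewrite /alt_terms mulr1 normrM normrX normrN1 expr1n mul1r.
Qed.

(** What the tails of an expansion and the remainders of an expansion algorithm
have in common; the bounds below use nothing else, and so apply to both. *)
Definition remainders (d : nat -> nat) (T : R^nat) : Prop :=
  (forall m, T m.+1 = (d m)%:R * D m.+1 - T m) /\ T @ \oo --> 0.

Definition tail (d : nat -> nat) : R^nat :=
  fun m => (-1) ^+ m * (alt_sum d - series (alt_terms d) m).

Lemma tail_remainders d : (forall j, (d j <= a j)%N) -> remainders d (tail d).
Proof.
move=> d_le; split=> [m|].
  rewrite /tail seriesSr /alt_terms exprS.
  have : (-1) ^+ m * (-1) ^+ m = 1 :> R by rewrite -expr2 sqrr_sign.
  set e := (-1) ^+ m; set s := series _ m => ee.
  transitivity ((e * e) * ((d m)%:R * D m.+1) - e * (alt_sum d - s)).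
    by ring.
  by rewrite ee mul1r.
apply: (cvg0_eq_norm _ (fun m => alt_sum d - series (alt_terms d) m)) => [m|].
  by rewrite /tail normrM normrX normrN1 expr1n mul1r.
rewrite -(subrr (alt_sum d)).
by apply: cvgB; [exact: cvg_cst|exact: alt_series_cvg].
Qed.

Lemma alt_sum_tail d m :
  alt_sum d = series (alt_terms d) m + (-1) ^+ m * tail d m.
Proof.
by rewrite /tail mulrA -expr2 sqrr_sign mul1r addrC subrK.
Qed.

Lemma remainders_alt_sum d T x : T 0 = x -> remainders d T -> alt_sum d = x.
Proof.
move=> T0 [TS T_cvg].
have ST : series (alt_terms d) = (fun m => x - (-1) ^+ m * T m).
  apply/funext; elim=> [|m IHm].
    by rewrite /series /= big_geq // T0; ring.
  by rewrite seriesSr IHm TS /alt_terms exprS; ring.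
rewrite /alt_sum; apply: cvg_lim => //; rewrite ST -[X in _ --> X]subr0.
apply: cvgB; first exact: cvg_cst.
apply: cvg0_eq_norm T_cvg => m.
by rewrite normrM normrX normrN1 expr1n mul1r.
Qed.

Lemma gap_cvg0 d T : remainders d T -> (fun m => D m - T m) @ \oo --> 0.
Proof.
by move=> [_ T_cvg]; rewrite -(subr0 0); apply: cvgB => //; apply: weights_cvg0.
Qed.

(** For digits bounded by [a] and positive weights, the gap to the bound
decreases over two steps, and stays the same exactly when a full digit is
followed by a zero. *)
Lemma gap_step d T m : remainders d T ->
  D m - T m = D m.+2 - T m.+2 +
    (((a m)%:R - (d m)%:R) * D m.+1 + (d m.+1)%:R * D m.+2).
Proof. by move=> [TS _]; rewrite !TS DSS; ring. Qed.

Lemma gap_loss_ge0 d m : (forall j, (d j <= a j)%N) ->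
  0 <= ((a m)%:R - (d m)%:R) * D m.+1 + (d m.+1)%:R * D m.+2.
Proof.
move=> d_le; rewrite addr_ge0 // mulr_ge0 ?ler0n ?(ltW (D_gt0 _)) //.
by rewrite subr_ge0 ler_nat.
Qed.

Lemma remainder_le d T m : (forall j, (d j <= a j)%N) -> remainders d T ->
  T m <= D m.
Proof.
move=> d_le dT; rewrite -subr_ge0.
apply: (even_steps_ge0 _ (fun m => D m - T m) m (gap_cvg0 _ _ dT)) => i.
by rewrite [leRHS](gap_step _ _ _ dT) lerDl gap_loss_ge0.
Qed.

(** Along such a tail the gap is constant in steps of two, hence equal to its
limit 0. *)
Lemma remainder_extremal d T k : remainders d T ->
  (forall i, d (k + i.*2)%N = a (k + i.*2)%N /\ d (k + i.*2).+1 = 0%N) ->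
  T k = D k.
Proof.
move=> dT dk.
have gapE i :
    D (k + i.*2).+2 - T (k + i.*2).+2 = D (k + i.*2)%N - T (k + i.*2)%N.
  have [da d0] := dk i.
  by rewrite [RHS](gap_step _ _ _ dT) da d0; ring.
have Tk := gap_cvg0 _ _ dT.
have : 0 <= D k - T k.
  by apply: (even_steps_ge0 _ (fun m => D m - T m)) => // i; rewrite gapE.
have NTk : (fun m => - (D m - T m)) @ \oo --> 0 by rewrite -oppr0; apply: cvgN.
have : 0 <= - (D k - T k).
  by apply: (even_steps_ge0 _ (fun m => - (D m - T m))) => // i; rewrite gapE.
lra.
Qed.

(** If the bound is attained at [m], every loss from [m] on vanishes, which
spells out the tail excluded by condition (c). *)
Lemma remainder_lt d T m : admissible_for a d -> remainders d T -> T m < D m.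
Proof.
move=> [d_le _ d_end] dT; rewrite lt_neqAle (remainder_le d) // andbT.
apply/eqP => Tm; apply: d_end; exists m => i.
have Ti : T (m + i.*2)%N = D (m + i.*2)%N.
  elim: i => [|i IHi]; first by rewrite addn0.
  have := remainder_le _ _ (m + i.*2).+2 d_le dT.
  have := gap_step _ _ (m + i.*2)%N dT; have := gap_loss_ge0 _ (m + i.*2) d_le.
  by rewrite doubleS !addnS IHi; lra.
have := gap_step _ _ (m + i.*2)%N dT; rewrite Ti.
have := remainder_le _ _ (m + i.*2).+2 d_le dT.
set n := (m + i.*2)%N => Tn loss.
have da : 0 <= ((a n)%:R - (d n)%:R) * D n.+1.
  by rewrite mulr_ge0 ?(ltW (D_gt0 _)) // subr_ge0 ler_nat.
have d0 : 0 <= (d n.+1)%:R * D n.+2 by rewrite mulr_ge0 ?(ltW (D_gt0 _)).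
have /eqP : ((a n)%:R - (d n)%:R) * D n.+1 = 0 by lra.
rewrite mulf_eq0 (gt_eqF (D_gt0 _)) orbF subr_eq0 eqr_nat => /eqP ->.
have /eqP : (d n.+1)%:R * D n.+2 = 0 by lra.
by rewrite mulf_eq0 (gt_eqF (D_gt0 _)) orbF pnatr_eq0 => /eqP ->.
Qed.

(** A nonzero digit brings at least one unit [D m.+1], and the next remainder
takes back less than that. *)
Lemma remainder_gt0 d T m : admissible_for a d -> remainders d T ->
  (0 < d m)%N -> 0 < T m.
Proof.
move=> dA dT dm; have := remainder_lt _ _ m.+1 dA dT.
case: dT => TS _; rewrite TS.
have : D m.+1 <= (d m)%:R * D m.+1.
  by rewrite ler_peMl ?(ltW (D_gt0 _)) // ler1n.
lra.
Qed.

Lemma remainder_eq0 d T m : remainders d T ->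
  (forall i, (m <= i)%N -> d i = 0%N) -> T m = 0.
Proof.
move=> dT d0.
have T2 i : T (m + i.*2).+2 = T (m + i.*2)%N.
  by case: dT => TS _; rewrite !TS !d0 ?mul0r; [ring|lia|lia].
case: (dT) => _ T_cvg.
have : 0 <= T m by apply: even_steps_ge0 => // i; rewrite T2.
have NT : (fun i => - T i) @ \oo --> 0 by rewrite -oppr0; apply: cvgN.
have : 0 <= - T m.
  by apply: (even_steps_ge0 _ (fun i => - T i)) => // i; rewrite T2.
lra.
Qed.

(** A remainder can only be negative at a zero digit that is not the start of a
zero tail; by condition (b) such a digit follows a full one. *)
Lemma remainder_ge0 d T m : admissible_for a d -> remainders d T ->
  (0 < m -> d m.-1 < a m.-1)%N -> 0 <= T m.
Proof.
move=> dA dT dm; have [d_le d_zero _] := dA.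
have [d0|d_gt0] := posnP (d m); last first.
  exact: ltW (remainder_gt0 _ _ _ dA dT d_gt0).
have [dz|[m_gt0 dpm]] := d_zero m d0.
  by rewrite (remainder_eq0 _ _ _ dT dz).
by move: (dm m_gt0); rewrite dpm ltnn.
Qed.

Lemma alt_sum_itv d : admissible_for a d -> 0 <= alt_sum d < D 0.
Proof.
move=> dA; have [d_le _ _] := dA.
have dT := tail_remainders _ d_le.
have -> : alt_sum d = tail d 0.
  by rewrite (alt_sum_tail d 0) /series /= big_geq // add0r mul1r.
by rewrite (remainder_lt _ _ _ dA dT) (remainder_ge0 _ _ _ dA dT).
Qed.

(** A digit smaller than another one is not full, so the remainder after it is
nonnegative; the remainder after the larger digit is less than one unit. *)
Lemma remainder_strict_mono d d' T T' j :
  admissible_for a d -> admissible_for a d' ->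
  remainders d T -> remainders d' T' -> (d j < d' j)%N -> T j < T' j.
Proof.
move=> dA d'A dT d'T' ltdd'.
have [d'_le _ _] := d'A.
have T1 : 0 <= T j.+1.
  by apply: remainder_ge0 dA dT _ => _; apply: leq_trans ltdd' (d'_le j).
have T'1 := remainder_lt _ _ j.+1 d'A d'T'.
move: T1 T'1; case: dT d'T' => [-> _] [-> _].
have : ((d j)%:R + 1) * D j.+1 <= (d' j)%:R * D j.+1.
  by rewrite ler_pM2r // natr1 ler_nat.
rewrite mulrDl mul1r; lra.
Qed.

Lemma alt_sum_strict_mono d d' j : admissible_for a d -> admissible_for a d' ->
  (-1) ^+ j * (d j)%:Z < (-1) ^+ j * (d' j)%:Z ->
  (forall i, (i < j)%N -> d i = d' i) -> alt_sum d < alt_sum d'.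
Proof.
move=> dA d'A ltdd' eqdd'; have [d_le _ _] := dA.
have [d'_le _ _] := d'A.
have dT := tail_remainders _ d_le; have d'T := tail_remainders _ d'_le.
rewrite (alt_sum_tail d j) (alt_sum_tail d' j).
have -> : series (alt_terms d) j = series (alt_terms d') j.
  by apply: eq_big_nat => i ltij; rewrite /alt_terms eqdd'.
rewrite ltrD2l; move: ltdd'; rewrite -signr_odd -[in X in _ -> X]signr_odd.
case: (odd j); rewrite ?mulN1r ?mul1r ?ltrN2 ltz_nat => ltdd';
  exact: remainder_strict_mono ltdd'.
Qed.

(** Rounding up, rather than down, leaves a nonnegative next remainder, since
that remainder enters with a minus sign. The cap at [a m] is what may turn the
next remainder negative. *)
Definition greedy_digit (m : nat) (t : R) : nat :=
  if t <= 0 then 0%N else minn (a m) `|Num.ceil (t / D m.+1)|%N.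

Lemma greedy_digitP m t : 0 < t ->
  let c := greedy_digit m t in
  [/\ (0 < c)%N, (c <= a m)%N, c%:R * D m.+1 < t + D m.+1
    & (c < a m)%N -> t <= c%:R * D m.+1].
Proof.
move=> t_gt0; rewrite /greedy_digit leNgt t_gt0 /=.
have y_gt0 : 0 < t / D m.+1 by rewrite divr_gt0.
have /andP[] := ceil_itv (t / D m.+1).
have : 0 < Num.ceil (t / D m.+1) by rewrite ceil_gt0.
case: (Num.ceil _) => [n|//] n_gt0; rewrite absz_nat intrD.
rewrite ltr_pdivlMr // ler_pdivrMr // mulrDl mulN1r => lt_t le_t.
have n_gt0' : (0 < n)%N by [].
split; [by rewrite leq_min a_gt0|exact: geq_minl| |].
  have : (minn (a m) n)%:R * D m.+1 <= n%:R * D m.+1.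
    by rewrite ler_pM2r // ler_nat geq_minr.
  move: lt_t; rewrite -pmulrn; lra.
by rewrite gtn_min ltnn /= => ltna; rewrite (minn_idPr (ltnW ltna)).
Qed.

Fixpoint greedy_remainder (x : R) (m : nat) : R :=
  if m is m'.+1 then
    let t := greedy_remainder x m' in (greedy_digit m' t)%:R * D m - t
  else x.

Definition greedy_digits (x : R) (m : nat) : nat :=
  greedy_digit m (greedy_remainder x m).

Lemma greedy_digits_le x m : (greedy_digits x m <= a m)%N.
Proof.
by rewrite /greedy_digits /greedy_digit; case: ifP => // _; apply: geq_minl.
Qed.

(** A remainder is negative only after a capped, hence full, digit, and then by
less than the next weight, so that the digit 0 brings it back in range. *)
Lemma greedy_invariant x m : 0 <= x < D 0 ->
  greedy_remainder x m < D m /\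
  (0 <= greedy_remainder x m \/
   [/\ (0 < m)%N, greedy_digits x m.-1 = a m.-1
     & - D m.+1 < greedy_remainder x m]).
Proof.
move=> /andP[x_ge0 x_lt]; elim: m => [|m [lt_t IHm]]; first by split=> //; left.
rewrite /greedy_digits /=; set t := greedy_remainder x m in lt_t IHm *.
have [t_le0|t_gt0] := leP t 0.
  rewrite /greedy_digit t_le0 mul0r sub0r; split; last by left; lra.
  by case: IHm => [t_ge0|[_ _ lt_t']]; have := D_gt0 m.+1; lra.
have [c_gt0 c_le c_lt c_ge] := greedy_digitP m t t_gt0.
split; first by lra.
have [c_lta|] := ltnP (greedy_digit m t) (a m).
  by left; have := c_ge c_lta; lra.
move=> le_ac; have {le_ac}ca : greedy_digit m t = a m.
  by apply/eqP; rewrite eqn_leq c_le.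
by right; split => //; rewrite ca DSS; lra.
Qed.

Lemma greedy_remainders x : 0 <= x < D 0 ->
  remainders (greedy_digits x) (greedy_remainder x).
Proof.
move=> x_itv; split=> //; apply: norm_cvg0.
apply: (@squeeze_cvgr _ _ _ _ (fun=> 0) D);
  [|exact: cvg_cst|exact: weights_cvg0].
near=> m; rewrite normr_ge0 /=.
have [lt_t t_lo] := greedy_invariant x m x_itv; have := D_lt m.
rewrite ler_norml => D_ltm; apply/andP; split; last by lra.
by case: t_lo => [|[_ _]]; have := D_gt0 m; lra.
Unshelve. all: by end_near.
Qed.

(** A zero digit is chosen exactly at a remainder at most 0: remainder 0 yields
zeros forever, and a negative one follows a full digit. The tail excluded by
(c) would force a remainder equal to its strict upper bound. *)
Lemma greedy_digits_admissible x : 0 <= x < D 0 ->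
  admissible_for a (greedy_digits x).
Proof.
move=> x_itv; split; first exact: greedy_digits_le.
- move=> j dj0.
  have t_le0 : greedy_remainder x j <= 0.
    rewrite leNgt; apply/negP => /(greedy_digitP j)[c_gt0 _ _ _].
    by rewrite -/(greedy_digits x j) dj0 in c_gt0.
  have [_ [t_ge0|[j_gt0 dpj _]]] := greedy_invariant x j x_itv; last by right.
  left=> i leji; rewrite -(subnKC leji).
  suff : greedy_remainder x (j + (i - j)) = 0.
    by rewrite /greedy_digits => ->; rewrite /greedy_digit lexx.
  elim: (i - j)%N => [|n IHn]; first by rewrite addn0; apply/le_anti/andP.
  by rewrite addnS /= IHn /greedy_digit lexx mul0r subr0.
- move=> [k dk]; have [lt_t _] := greedy_invariant x k x_itv.
  have dT := greedy_remainders _ x_itv.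
  by move: lt_t; rewrite (remainder_extremal _ _ _ dT dk) ltxx.
Qed.

Lemma alt_sum_surj x : 0 <= x < D 0 ->
  exists2 d, admissible_for a d & alt_sum d = x.
Proof.
move=> x_itv; exists (greedy_digits x); first exact: greedy_digits_admissible.
exact: remainders_alt_sum (greedy_remainders _ x_itv).
Qed.

End AlternatingExpansion.

(** * Convergents and the Gauss map *)

(** The recursion peels the first quotient, as [cfrac] does, so that both the
value of the fraction and coprimality follow by direct induction. The usual
recurrence, which peels the last one, is [continuantsSS]. *)
Fixpoint continuants (a : nat -> nat) (k : nat) : nat * nat :=
  if k is k'.+1 then
    let: (p, q) := continuants (fun j => a j.+1) k' in (q, (a 0 * q + p)%N)
  else (0%N, 1%N).

Lemma continuantsSS a k :
  continuants a k.+2 =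
    ((a k.+1 * (continuants a k.+1).1 + (continuants a k).1)%N,
     (a k.+1 * (continuants a k.+1).2 + (continuants a k).2)%N).
Proof.
elim: k a => [|k IHk] a; first by rewrite /=; congr pair; lia.
rewrite [LHS]/= -/(continuants (fun j => a j.+1) k.+2) IHk /=.
case: (continuants (fun j => a j.+2) k) => p q /=.
by case: (continuants (fun j => a j.+1) k) => p' q' /=; congr pair; lia.
Qed.

Lemma continuants_coprime a k :
  coprime (continuants a k).1 (continuants a k).2.
Proof.
elim: k a => [|k IHk] a //=; have := IHk (fun j => a j.+1).
case: continuants => p q /= pq.
by rewrite /coprime gcdnMDl gcdnC.
Qed.

Lemma continuants_den_gt0 a k :
  (forall j, (0 < a j)%N) -> (0 < (continuants a k).2)%N.
Proof.
elim: k a => [|k IHk] a a_gt0 //=.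
have := IHk (fun j => a j.+1) (fun j => a_gt0 j.+1).
by case: continuants => p q /= q_gt0; rewrite addn_gt0 muln_gt0 a_gt0 q_gt0.
Qed.

Lemma cfrac_mkseq a k : (forall j, (0 < a j)%N) ->
  cfrac (mkseq a k) = (continuants a k).1%:R / (continuants a k).2%:R.
Proof.
elim: k a => [|k IHk] a a_gt0; first by rewrite mul0r.
rewrite /mkseq /= -[1%N]/(1 + 0)%N iotaDl -map_comp.
rewrite -/(mkseq (fun j => a j.+1) k) IHk //.
have := continuants_den_gt0 _ k (fun j => a_gt0 j.+1).
case: continuants => p q /= q_gt0.
have q0 : q%:R != 0 :> rat by rewrite pnatr_eq0 -lt0n.
by rewrite natrD natrM -[in RHS]invf_div; congr (_^-1); field.
Qed.

Section Expansion.

Variables (R : realType) (alpha : R).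
Hypotheses (alpha01 : 0 < alpha < 1) (alpha_irr : irrational alpha).

Let a := partial_quotient alpha.

Definition gauss_iter (j : nat) : R := iter j (fun x => frac_part x^-1) alpha.

Lemma irrational_neq0 (x : R) : irrational x -> x != 0.
Proof.
move=> irrx; apply/eqP => x0; apply: irrx.
by exists 0 => //=; rewrite raddf0.
Qed.

Lemma frac_part_itv (x : R) : 0 <= frac_part x < 1.
Proof. by have := floor_itv x; rewrite /frac_part intrD => /andP[? ?]; lra. Qed.

Lemma irrational_gauss (x : R) : irrational x -> irrational (frac_part x^-1).
Proof.
move=> irrx [r _ rE]; apply: irrx; exists (r + (Num.floor x^-1)%:~R)^-1 => //=.
by rewrite fmorphV raddfD /= rE ratr_int /frac_part subrK invrK.
Qed.

Lemma gauss_iter_irr j : irrational (gauss_iter j).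
Proof. by elim: j => //= j; apply: irrational_gauss. Qed.

(** Irrationality is what keeps the orbit away from 0. *)
Lemma gauss_iter_itv j : 0 < gauss_iter j < 1.
Proof.
have := irrational_neq0 _ (gauss_iter_irr j).
case: j => [|j] /= x0; first by [].
have /andP[x_ge0 ->] := frac_part_itv (gauss_iter j)^-1.
by rewrite lt_def x0 x_ge0.
Qed.

Lemma gauss_iterS j : gauss_iter j.+1 = (gauss_iter j)^-1 - (a j)%:R.
Proof.
have /andP[x_gt0 _] := gauss_iter_itv j.
have x_ge0 : 0 <= (gauss_iter j)^-1 by rewrite invr_ge0 ltW.
rewrite /= /frac_part /a /partial_quotient -/(gauss_iter j).
rewrite truncn_floor x_ge0.
by rewrite natr_absz ger0_norm // floor_ge0.
Qed.

Lemma partial_quotient_gt0 j : (0 < a j)%N.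
Proof.
have /andP[x_gt0 x_lt1] := gauss_iter_itv j.
by rewrite /a /partial_quotient -/(gauss_iter j) truncn_gt0 invf_ge1 // ltW.
Qed.

(** The product formula $\delta_{j-1} = \prod_{i<j} G^i(\alpha)$: in this form
positivity, monotonicity and the recurrence are read off the orbit. *)
Definition weightR (j : nat) : R := \prod_(i < j) gauss_iter i.

Lemma weightR0 : weightR 0 = 1. Proof. by rewrite /weightR big_ord0. Qed.

Lemma weightR1 : weightR 1 = alpha. Proof. by rewrite /weightR big_ord1. Qed.

Lemma weightR_gt0 j : 0 < weightR j.
Proof. by apply: prodr_gt0 => i _; case/andP: (gauss_iter_itv i). Qed.

Lemma weightRS j : weightR j.+1 = weightR j * gauss_iter j.
Proof. by rewrite /weightR big_ord_recr. Qed.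

Lemma weightRSS j : weightR j.+2 = weightR j - (a j)%:R * weightR j.+1.
Proof.
have /andP[x_gt0 _] := gauss_iter_itv j.
by rewrite !weightRS gauss_iterS; field; rewrite gt_eqF.
Qed.

Lemma weightR_lt j : weightR j.+1 < weightR j.
Proof.
rewrite weightRS gtr_pMr; last exact: weightR_gt0.
by case/andP: (gauss_iter_itv j).
Qed.

Lemma convergent_continuants k : convergent alpha k =
  (continuants a k).1%:Z%:~R / (continuants a k).2%:Z%:~R.
Proof.
by rewrite /convergent cfrac_mkseq // => j; apply: partial_quotient_gt0.
Qed.

Lemma cf_numE k : cf_num alpha k = (continuants a k).1%:Z.
Proof.
have q_gt0 := continuants_den_gt0 _ k partial_quotient_gt0.
rewrite /cf_num convergent_continuants coprimeq_num ?continuants_coprime //.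
by rewrite gtr0_sg ?mul1r // ltz_nat.
Qed.

Lemma cf_denE k : cf_den alpha k = (continuants a k).2.
Proof.
have q_gt0 := continuants_den_gt0 _ k partial_quotient_gt0.
rewrite /cf_den convergent_continuants coprimeq_den ?continuants_coprime //.
by case: ifP => [/eqP|_]; lia.
Qed.

(** Both sides satisfy the same second-order recurrence with the same first two
values. *)
Lemma cf_deltaE k : cf_delta alpha k = weightR k.+1.
Proof.
rewrite /cf_delta cf_denE cf_numE.
have [n] := ubnP k; elim: n k => // n IHn [|[|k]] ltkn.
- by rewrite weightR1 /=; ring.
- by rewrite weightRSS weightR0 weightR1 /= natrD natrM; ring.
- rewrite weightRSS -!IHn; [|lia|lia].
  rewrite continuantsSS /= !PoszD !PoszM !intrD !intrM !natrD !natrM !exprS.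
  by ring.
Qed.

End Expansion.

(** * Order isomorphisms *)

(** On a total order, strict monotonicity already gives injectivity and the
converse implication. *)
Lemma strict_mono_order_iso (T : Type) (disp : Order.disp_t)
    (U : orderType disp) (A : set T) (lt : T -> T -> Prop) (B : set U)
    (f : T -> U) :
  (forall x y, A x -> A y -> x <> y -> lt x y \/ lt y x) ->
  (forall x y, A x -> A y -> lt x y -> (f x < f y)%O) ->
  (forall x, A x -> B (f x)) -> (forall y, B y -> exists2 x, A x & f x = y) ->
  order_iso A (fun x y => x = y \/ lt x y) B (fun u v : U => (u <= v)%O) f.
Proof.
move=> lt_total f_mono f_fun f_surj; split; first split.
- by move=> x Ax; apply: f_fun.
- move=> x y /set_mem Ax /set_mem Ay fxy; apply: contrapT => neqxy.
  have [/(f_mono _ _ Ax Ay)|/(f_mono _ _ Ay Ax)] := lt_total x y Ax Ay neqxy;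
    by rewrite fxy ltxx.
- by move=> y /f_surj[x Ax <-]; exists x.
- move=> x y Ax Ay; split=> [[->//|ltxy]|lefxy]; first exact/ltW/f_mono.
  have [->|neqxy] := EM (x = y); first by left.
  right; have [//|/(f_mono _ _ Ay Ax)] := lt_total x y Ax Ay neqxy.
  by rewrite ltNge lefxy.
Qed.

Lemma last_difference (d d' : nat -> nat) (N : nat) :
  (forall i, (N <= i)%N -> d i = d' i) -> d <> d' ->
  exists2 j, d j != d' j & forall i, (j < i)%N -> d i = d' i.
Proof.
move=> eqN; elim: N eqN => [|N IHN] eqN neqdd'.
  by case: neqdd'; apply/funext => i; apply: eqN.
have [eqdN|neqdN] := eqVneq (d N) (d' N); last by exists N.
by apply: IHN => // i; rewrite leq_eqVlt => /predU1P[<-|/eqN].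
Qed.

Lemma first_difference (d d' : nat -> nat) : d <> d' ->
  exists2 j, d j != d' j & forall i, (i < j)%N -> d i = d' i.
Proof.
move=> neqdd'; have [|j neqj minj] := @ex_minnP (fun j => d j != d' j).
  apply: contrapT => nex; apply: neqdd'; apply/funext => j; apply/eqP.
  by apply: contrapT => /negP neqj; apply: nex; exists j.
exists j => // i ltij; apply/eqP; apply: contraTT ltij => /minj.
by rewrite -leqNgt.
Qed.

Section Isomorphisms.

Variables (R : realType) (alpha : R).
Hypotheses (alpha01 : 0 < alpha < 1) (alpha_irr : irrational alpha).

Let a := partial_quotient alpha.
Let a_gt0 := partial_quotient_gt0 R alpha alpha01 alpha_irr.

(** The denominators shifted by one, to start at $q_{-1} = 0$. *)
Definition weightN (j : nat) : nat := if j is k.+1 then cf_den alpha k else 0%N.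

Lemma weightN1 : weightN 1 = 1%N.
Proof. by rewrite /= cf_denE. Qed.

Lemma weightNSS j : weightN j.+2 = (a j * weightN j.+1 + weightN j)%N.
Proof.
case: j => [|j]; rewrite /weightN !cf_denE //; last by rewrite continuantsSS.
Qed.

Lemma PsiE d N : (forall i, (N <= i)%N -> d i = 0%N) ->
  Psi alpha d = digit_sum weightN d N.
Proof.
move=> d0; rewrite /Psi /digit_sum.
rewrite -(big_mkord xpredT (fun j => d j * weightN j.+1)%N).
rewrite [RHS]fsbig_seq ?iota_uniq //; symmetry.
apply: fsbig_widen => // j [_ /= jN]; rewrite d0 //.
by move: jN; rewrite mem_index_iota /= => /negP; rewrite -leqNgt.
Qed.

Lemma fin_admissible_zeros d j : fin_admissible alpha d -> (0 < d j)%N ->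
  zeros_after_full a d j.
Proof.
move=> [[_ d_zero _] _] dj i ltij /d_zero[/(_ j (ltnW ltij)) dj0|//].
by rewrite dj0 in dj.
Qed.

Lemma Psi_strict_mono d d' j :
  fin_admissible alpha d -> fin_admissible alpha d' -> (d j < d' j)%N ->
  (forall i, (j < i)%N -> d i = d' i) -> (Psi alpha d < Psi alpha d')%N.
Proof.
move=> dA d'A ltdd' eqdd'.
have [[d_le _ _] [N dN]] := dA; have [_ [N' d'N']] := d'A.
rewrite (PsiE d (j.+1 + (N + N'))); last by move=> i leNi; apply: dN; lia.
rewrite (PsiE d' (j.+1 + (N + N'))); last by move=> i leNi; apply: d'N'; lia.
elim: (N + N')%N => [|k IHk].
  rewrite addn0.
  apply: (digit_sum_strict_mono a weightN erefl weightN1 weightNSS) => //.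
  by apply: fin_admissible_zeros => //; lia.
by rewrite addnS !(digit_sumS _ _ (j.+1 + k)) eqdd' ?ltn_add2r //; lia.
Qed.

(** For the least [k] with [n < weightN k.+1 + weightN k], minimality at
[k.-1] gives the lower bound that the digits below [k] need. *)
Lemma Psi_surj n : exists2 d, fin_admissible alpha d & Psi alpha d = n.
Proof.
have W_gt0 := weight_gt0 a a_gt0 _ weightN1 weightNSS.
have W_le k : (k <= weightN k.+1 + weightN k)%N.
  elim: k => // k IHk; rewrite weightNSS.
  have := W_gt0 k; have := leq_mul (a_gt0 k) (leqnn (weightN k.+1)).
  by rewrite /a; lia.
have ex_k : exists k, (n < weightN k.+1 + weightN k)%N.
  by exists n.+1; apply: leq_trans (W_le n.+1).
have [k ltnk mink] := ex_minnP ex_k.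
have lekn : (weightN k <= n)%N.
  case: k => // k in ltnk mink *; rewrite leqNgt; apply/negP => ltnk1.
  by have := mink k (ltn_addr _ ltnk1); rewrite ltnn.
have [|d [d_le zd d0 vd]] :=
  digit_sum_surj a a_gt0 weightN erefl weightN1 weightNSS k n.
  by rewrite lekn.
exists d; last by rewrite (PsiE _ _ d0).
split; last by exists k.
split=> // [j dj0|[i di]].
  by have [/zd/(_ dj0)|lekj] := ltnP j k; [right|left=> i /(leq_trans lekj)/d0].
have [] := di k; rewrite d0; last by lia.
by have := a_gt0 (i + k.*2)%N; rewrite /a => /[swap] <-.
Qed.

Lemma Psi_order_iso :
  order_iso (fin_admissible alpha) le_revlex [set: nat] leq (Psi alpha).
Proof.
apply: (@strict_mono_order_iso _ _ nat _ (fun d d' =>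
  exists j, (d j < d' j)%N /\ forall i, (j < i)%N -> d i = d' i)) => //.
- move=> d d' [_ [N dN]] [_ [N' d'N']] neqdd'.
  have [i leNi||j neqj eqj] := @last_difference d d' (N + N') => //.
    by rewrite dN ?d'N' //; lia.
  have [ltj|ltj|eqdj] := ltngtP (d j) (d' j); last by rewrite eqdj eqxx in neqj.
    by left; exists j.
  by right; exists j; split=> // i /eqj.
- by move=> d d' dA d'A [j [ltj eqj]]; apply: Psi_strict_mono eqj.
- by move=> n _; apply: Psi_surj.
Qed.

Let D := weightR R alpha.
Let D_gt0 := weightR_gt0 R alpha alpha01 alpha_irr.
Let D_lt := weightR_lt R alpha alpha01 alpha_irr.
Let DSS := weightRSS R alpha alpha01 alpha_irr.

Lemma Lambda_termsE d : Lambda_terms alpha d = alt_terms R D d.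
Proof. by apply/funext => j; rewrite /Lambda_terms cf_deltaE. Qed.

Lemma LambdaE d : Lambda alpha d = alt_sum R D d.
Proof. by rewrite /Lambda Lambda_termsE. Qed.

Lemma Lambda_cvg d : admissible alpha d -> cvgn (series (Lambda_terms alpha d)).
Proof.
move=> [d_le _ _]; rewrite Lambda_termsE.
exact: (alt_series_cvg R a D D_gt0 DSS).
Qed.

Lemma Lambda_itv d : admissible alpha d -> 0 <= Lambda alpha d < 1.
Proof.
move=> dA; rewrite LambdaE -(weightR0 R alpha).
exact: (alt_sum_itv R a a_gt0 D D_gt0 DSS d dA).
Qed.

Lemma Lambda_order_iso :
  order_iso (admissible alpha) le_altlex `[0, 1[ <=%R (Lambda alpha).
Proof.
apply: (@strict_mono_order_iso _ _ R _ (fun d d' =>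
  exists j, (-1) ^+ j * (d j)%:Z < (-1) ^+ j * (d' j)%:Z /\
            forall i, (i < j)%N -> d i = d' i)).
- move=> d d' _ _ /first_difference[j neqj eqj].
  have : (-1) ^+ j * (d j)%:Z != (-1) ^+ j * (d' j)%:Z.
    by rewrite (inj_eq (mulfI _)) // signr_eq0.
  by rewrite neq_lt => /orP[ltj|ltj]; [left|right]; exists j; split=> // i /eqj.
- move=> d d' dA d'A [j [ltj eqj]]; rewrite !LambdaE.
  exact: (alt_sum_strict_mono R a a_gt0 D D_gt0 DSS d d' j).
- by move=> d /Lambda_itv; rewrite /= in_itv.
- move=> x; rewrite /= in_itv /= -(weightR0 R alpha) => x_itv.
  have [d dA <-] := alt_sum_surj R a a_gt0 D D_gt0 D_lt DSS x x_itv.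
  by exists d => //; rewrite LambdaE.
Qed.

Lemma Lambda_finE d N : (forall i, (N <= i)%N -> d i = 0%N) ->
  Lambda alpha d = (Psi alpha d)%:R * alpha -
    (\sum_(j < N) (d j)%:Z * cf_num alpha j)%:~R.
Proof.
move=> d0; rewrite (PsiE _ _ d0).
have -> : Lambda alpha d = series (Lambda_terms alpha d) N.
  apply: lim_near_cst => //; exists N => // n /= leNn.
  rewrite /series /= (big_cat_nat (leq0n N) leNn) //=.
  rewrite -[RHS]addr0; congr (_ + _).
  rewrite big_nat big1 // => i /andP[leNi _].
  by rewrite /Lambda_terms d0 // mulr0 mul0r.
rewrite /series /= big_mkord /digit_sum natr_sum mulr_suml rmorph_sum /=.
rewrite -sumrB; apply: eq_bigr => j _.
rewrite /Lambda_terms /cf_delta natrM intrM -pmulrn.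
have : (-1) ^+ j * (-1) ^+ j = 1 :> R by rewrite -expr2 sqrr_sign.
set e := (-1) ^+ j => ee.
transitivity ((e * e) * ((d j)%:R *
  ((cf_den alpha j)%:R * alpha - (cf_num alpha j)%:~R))); first by ring.
by rewrite ee mul1r; ring.
Qed.

(** The two arguments differ by an integer, and [Lambda alpha d] is in
$[0, 1)$. *)
Lemma frac_part_Psi d : fin_admissible alpha d ->
  frac_part ((Psi alpha d)%:R * alpha) = Lambda alpha d.
Proof.
move=> [dA [N d0]]; have := Lambda_finE _ _ d0; have := Lambda_itv _ dA.
set p := (\sum_(j < N) _) => L_itv LE; rewrite LE /frac_part.
congr (_ - _%:~R); apply: floor_def; move: L_itv.
rewrite LE intrD => /andP[? ?].
lra.
Qed.

End Isomorphisms.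

Theorem proposition4 (R : realType) (alpha : R)
    (alpha01 : 0 < alpha < 1) (alpha_irr : irrational alpha) :
  [/\ order_iso (fin_admissible alpha) le_revlex [set: nat] leq (Psi alpha),
      (forall d, admissible alpha d -> cvgn (series (Lambda_terms alpha d))) /\
      order_iso (admissible alpha) le_altlex `[0, 1[ <=%R (Lambda alpha)
    & forall n : nat, frac_part (n%:R * alpha) = Lambda alpha (Psi_inv alpha n)].
Proof.
have Psi_iso := Psi_order_iso R alpha alpha01 alpha_irr.
split=> // [|n].
  by split; [move=> d; apply: Lambda_cvg|apply: Lambda_order_iso].
have [[_ Psi_inj Psi_onto] _] := Psi_iso.
have [d dA <-] := Psi_onto n I.
rewrite /Psi_inv pinvKV ?mem_set //; exact: frac_part_Psi.
Qed.
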